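(* Let $G$ be a finite group with identity element $e$, and let $p$ be any prime number. Then the following statements hold. (i) All the elements in the $p$-th grade of $\mathbb{N}[G]$ are prime: $\mathrm{Pr}(\mathbb{N}[G])_p=\mathbb{N}[G]_p$. In particular, $\left|\mathrm{Pr}(\mathbb{N}[G])_p\right|=\binom{p+|G|-1}{|G|-1}$. (ii) For every integer $n\ge 2$, $$\mathrm{Comp}(\mathbb{N}[G])_n=\bigcup_{\substack{d\mid n\\ 1<d<n}}\mathbb{N}[G]_d\,\mathbb{N}[G]_{n/d},$$ where $\mathbb{N}[G]_d\,\mathbb{N}[G]_{n/d}=\{uv: u\in\mathbb{N}[G]_d,\ v\in\mathbb{N}[G]_{n/d}\}$. (iii) For every integer $n\ge 2$ and every $h\in G$ with $h\ne e$, the element $e+(n-1)h$ of $\mathbb{N}[G]$ is a prime.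
   Context: $\mathbb{N}=\{0,1,2,\ldots\}$. For a finite group $G$, the group semiring is $\mathbb{N}[G]=\{\sum_{g\in G}a_g g: a_g\in\mathbb{N}\}$ with coefficientwise addition and multiplication $\left(\sum_g a_g g\right)\left(\sum_g b_g g\right)=\sum_{g\in G}\left(\sum_{g_1g_2=g}a_{g_1}b_{g_2}\right)g$. Its multiplicative identity is the identity element of $G$ (with coefficient 1), and one writes $g$ for $1\cdot g$. For $k\in\mathbb{N}$, the $k$-th grade is $\mathbb{N}[G]_k=\{\sum_g a_g g\in\mathbb{N}[G]:\sum_{g\in G} a_g=k\}$. A non-zero element $u$ of a semiring $S$ with $0$ and $1$ is a unit if there exists $v\in S$ with $uv=1$. A non-zero non-unit $w\in S$ is called a prime if for all $u,v\in S$ with $uv=w$, either $u$ or $v$ is a unit. A non-zero non-unit element that is not prime is called a composite. $\mathrm{Pr}(\mathbb{N}[G])_k$ denotes the set of elements of $\mathbb{N}[G]_k$ that are primes of the semiring $S=\mathbb{N}[G]$ (non-zero non-units $w$ such that $uv=w$ with $u,v\in\mathbb{N}[G]$ forces $u$ or $v$ to be a unit), and $\mathrm{Comp}(\mathbb{N}[G])_k$ denotes the set of elements of $\mathbb{N}[G]_k$ that are composites of $\mathbb{N}[G]$ (non-zero non-units that are not prime). *)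

(* Defs.v *)
From HB Require Import structures.
From mathcomp Require Import all_boot all_algebra fingroup.
From mathcomp Require Import classical_sets cardinality.

Set Implicit Arguments.
Unset Strict Implicit.
Unset Printing Implicit Defensive.

Import GRing.Theory.
Local Open Scope ring_scope.

(* N[G], as functions G -> nat. The alias prevents the convolution product
   below from being confused with the library's pointwise product on {ffun _}. *)
Definition group_semiring (gT : finGroupType) : Type := {ffun gT -> nat}.

HB.instance Definition _ (gT : finGroupType) :=
  GRing.Nmodule.copy (group_semiring gT) {ffun gT -> nat}.

Section GroupSemiring.
Variable gT : finGroupType.
Implicit Types u v w : group_semiring gT.

Definition gelt (g : gT) : group_semiring gT := [ffun x => nat_of_bool (x == g)].

Definition gmul u v : group_semiring gT :=
  [ffun g => (\sum_(q : gT * gT | (q.1 * q.2)%g == g) u q.1 * v q.2)%N].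

Definition gdeg u : nat := (\sum_(g : gT) u g)%N.

Lemma gaddE u v g : (u + v) g = (u g + v g)%N.
Proof. by rewrite ffunE. Qed.

Lemma gmulEl u v g : gmul u v g = (\sum_(x : gT) u x * v (x^-1 * g)%g)%N.
Proof.
rewrite ffunE (reindex_onto (fun x => (x, (x^-1 * g)%g)) fst) /=; last first.
  by move=> [x y] /= /eqP <-; rewrite mulKg.
by apply: eq_bigl => x; rewrite mulKVg !eqxx.
Qed.

Lemma gmulEr u v g : gmul u v g = (\sum_(y : gT) u (g * y^-1)%g * v y)%N.
Proof.
rewrite ffunE (reindex_onto (fun y => ((g * y^-1)%g, y)) snd) /=; last first.
  by move=> [x y] /= /eqP <-; rewrite mulgK.
by apply: eq_bigl => x; rewrite mulgKV !eqxx.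
Qed.

Fact gmulA : associative gmul.
Proof.
move=> u v w; apply/ffunP => g; rewrite gmulEl gmulEr.
transitivity
  (\sum_(x : gT) \sum_(z : gT) u x * (v (x^-1 * g * z^-1)%g * w z))%N.
  by apply: eq_bigr => x _; rewrite gmulEr big_distrr.
rewrite exchange_big; apply: eq_bigr => z _; rewrite gmulEl big_distrl.
by apply: eq_bigr => x _; rewrite /= mulnA mulgA.
Qed.

Fact gmul1l : left_id (gelt 1%g) gmul.
Proof.
move=> u; apply/ffunP => g; rewrite gmulEl (bigD1 1%g) //= big1 ?addn0.
  by rewrite ffunE eqxx mul1n invg1 mul1g.
by move=> x /negPf x1; rewrite ffunE x1.
Qed.

Fact gmul1r : right_id (gelt 1%g) gmul.
Proof.
move=> u; apply/ffunP => g; rewrite gmulEr (bigD1 1%g) //= big1 ?addn0.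
  by rewrite ffunE eqxx muln1 invg1 mulg1.
by move=> x /negPf x1; rewrite ffunE x1 muln0.
Qed.

Fact gmulDl : left_distributive gmul +%R.
Proof.
move=> u v w; apply/ffunP => g; rewrite gaddE !gmulEl -big_split.
by apply: eq_bigr => x _; rewrite gaddE mulnDl.
Qed.

Fact gmulDr : right_distributive gmul +%R.
Proof.
move=> u v w; apply/ffunP => g; rewrite gaddE !gmulEl -big_split.
by apply: eq_bigr => x _; rewrite gaddE mulnDr.
Qed.

Fact gmul0l : left_zero 0 gmul.
Proof.
by move=> u; apply/ffunP => g; rewrite gmulEl big1 ?ffunE // => x _; rewrite ffunE.
Qed.

Fact gmul0r : right_zero 0 gmul.
Proof.
move=> u; apply/ffunP => g; rewrite gmulEl big1 ?ffunE // => x _.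
by rewrite ffunE muln0.
Qed.

Fact gone_neq0 : gelt 1%g != 0.
Proof. by apply/eqP => /ffunP /(_ 1%g); rewrite !ffunE eqxx. Qed.

HB.instance Definition _ := GRing.Nmodule_isNzSemiRing.Build (group_semiring gT)
  gmulA gmul1l gmul1r gmulDl gmulDr gmul0l gmul0r gone_neq0.

End GroupSemiring.

Section Primes.
Variable S : nzSemiRingType.

(* The invertibility is one-sided, and S need not be commutative. *)
Definition is_unit (u : S) : Prop := u <> 0 /\ exists v : S, u * v = 1.

Definition is_prime (w : S) : Prop :=
  [/\ w <> 0, ~ is_unit w & forall u v : S, u * v = w -> is_unit u \/ is_unit v].

Definition is_composite (w : S) : Prop :=
  [/\ w <> 0, ~ is_unit w & ~ is_prime w].

End Primes.

Local Open Scope classical_set_scope.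

Definition grade (gT : finGroupType) (k : nat) : set (group_semiring gT) :=
  [set u | gdeg u = k].
Arguments grade : clear implicits.

Definition Pr (gT : finGroupType) (k : nat) : set (group_semiring gT) :=
  [set w | grade gT k w /\ is_prime w].
Arguments Pr : clear implicits.

Definition Comp (gT : finGroupType) (k : nat) : set (group_semiring gT) :=
  [set w | grade gT k w /\ is_composite w].
Arguments Comp : clear implicits.

(* Main.v *)
Require Import Defs.
From mathcomp Require Import all_boot all_algebra fingroup.
From mathcomp Require Import classical_sets cardinality.
From mathcomp Require Import boolp.

(** The degree (sum of the coefficients) is a semiring morphism from N[G] to N,
    and the units are exactly the elements of degree 1 ([gdegM] and
    [is_unit_gdeg1]).  Hence an element of degree at least 2 is prime iff each
    of its factorizations has a factor of degree 1 ([is_prime_gdeg]), which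
    turns the first two claims into arithmetic of degrees.  In prime degree one
    of the two degrees must be 1; in degree n, the composites are the products
    whose degrees form a nontrivial factorization of n.  Counting the elements
    of a given degree is counting weak compositions of an integer.

    The last claim needs the group.  Suppose w = e + (n-1)h = uv with both
    degrees at least 2.  The coefficient of e in w is 1, so there is a single x
    with x in supp u and x^-1 in supp v, and both coefficients are 1.  The
    degrees leave another y in supp u and another z in supp v.  Since w is
    supported on {e, h}, the products y x^-1 and x z, which are not e, equal h;
    so y z = (h x)(x^-1 h) = h^2.  This is again e or h.  It is not h because h
    is not e, and it is not e because (y, y^-1) would be a second pair
    contributing to the coefficient of e. *)

Import GRing.Theory.

Local Open Scope ring_scope.
Local Open Scope classical_set_scope.
Local Open Scope card_scope.

Lemma gmulE {gT : finGroupType} (u v : group_semiring gT) (g : gT) :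
  (u * v) g = (\sum_(x : gT) u x * v (x^-1 * g)%g)%N.
Proof. exact: gmulEl. Qed.

Lemma gdegD {gT : finGroupType} (u v : group_semiring gT) :
  gdeg (u + v) = (gdeg u + gdeg v)%N.
Proof. by rewrite /gdeg -big_split; apply: eq_bigr => g _; rewrite gaddE. Qed.

Lemma gdeg0 {gT : finGroupType} : gdeg (0 : group_semiring gT) = 0%N.
Proof. by rewrite /gdeg big1 // => g _; rewrite ffunE. Qed.

Lemma gdegMn {gT : finGroupType} (u : group_semiring gT) (n : nat) :
  gdeg (u *+ n) = (gdeg u * n)%N.
Proof.
elim: n => [|n IHn]; first by rewrite mulr0n gdeg0 muln0.
by rewrite mulrS gdegD IHn mulnS.
Qed.

Lemma gdeg_gelt {gT : finGroupType} (g : gT) : gdeg (gelt g) = 1%N.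
Proof.
rewrite /gdeg (bigD1 g) //= big1 => [|x /negPf xg]; first by rewrite ffunE eqxx.
by rewrite ffunE xg.
Qed.

Lemma gdegM {gT : finGroupType} (u v : group_semiring gT) :
  gdeg (u * v) = (gdeg u * gdeg v)%N.
Proof.
rewrite /gdeg (eq_bigr _ (fun g _ => gmulE u v g)) exchange_big big_distrl.
apply: eq_bigr => x _; rewrite -big_distrr /=; congr muln.
rewrite (reindex_inj (mulgI x)).
by apply: eq_bigr => g _; rewrite mulKg.
Qed.

Lemma gmul_gelt {gT : finGroupType} (g h : gT) :
  gelt g * gelt h = gelt (g * h)%g.
Proof.
apply/ffunP => x; rewrite gmulE (bigD1 g) //= big1 => [|y /negPf yg].
  by rewrite !ffunE eqxx mul1n addn0 (canF_eq (mulKVg g)).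
by rewrite ffunE yg.
Qed.

(** Coefficients are natural numbers, so a sum equal to 1 has a single nonzero
    term. *)
Lemma gdeg1_gelt {gT : finGroupType} (u : group_semiring gT) :
  gdeg u = 1%N -> exists g, u = gelt g.
Proof.
move/eqP/sum_nat_eq1 => [g [_ ug1 u0]]; exists g; apply/ffunP => x.
by rewrite ffunE; have [->|/u0->] := eqVneq x g.
Qed.

(** Invertibility forces degree 1 because degrees multiply and 1 is the only
    unit of the natural numbers; conversely an element of degree 1 is a group
    element, inverted by its inverse in the group. *)
Lemma is_unit_gdeg1 {gT : finGroupType} (u : group_semiring gT) :
  is_unit u <-> gdeg u = 1%N.
Proof.
split=> [[_ [v uv1]]|/gdeg1_gelt[g ->]].
  have := gdegM u v; rewrite uv1 gdeg_gelt => /esym/eqP.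
  by rewrite muln_eq1 => /andP[/eqP].
split; last by exists (gelt g^-1%g); rewrite gmul_gelt mulgV.
by move=> g0; have := gdeg_gelt g; rewrite g0 gdeg0.
Qed.

Lemma gdeg_gt1_nonzero_nonunit {gT : finGroupType} (w : group_semiring gT) :
  (1 < gdeg w)%N -> w <> 0 /\ ~ is_unit w.
Proof.
move=> w_gt1; split=> [w0|/is_unit_gdeg1 w1]; last by rewrite w1 in w_gt1.
by rewrite w0 gdeg0 in w_gt1.
Qed.

Lemma is_prime_gdeg {gT : finGroupType} (w : group_semiring gT) :
  (1 < gdeg w)%N ->
  is_prime w <-> forall u v, u * v = w -> gdeg u = 1%N \/ gdeg v = 1%N.
Proof.
move=> /gdeg_gt1_nonzero_nonunit[w0 wU]; split=> [[_ _ pr_w] u v /pr_w|pr_w].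
  by rewrite !is_unit_gdeg1.
by split=> // u v /pr_w; rewrite !is_unit_gdeg1.
Qed.

Lemma Pr_prime_grade {gT : finGroupType} (p : nat) :
  prime p -> Pr gT p = grade gT p.
Proof.
move=> p_pr; apply/seteqP; split=> [w [] //|w wp].
split=> //; apply/is_prime_gdeg; first by rewrite wp prime_gt1.
move=> u v uv_w; have /esym := gdegM u v; rewrite uv_w wp => uv_p.
have /(primeP p_pr).2/orP[/eqP ?|/eqP ?] : (gdeg u %| p)%N.
- by rewrite -uv_p dvdn_mulr.
- by left.
- right; apply/eqP; rewrite -(eqn_pmul2l (prime_gt0 p_pr)) muln1.
  by rewrite -[X in _ == X]uv_p; apply/eqP; congr muln.
Qed.

(** A factorization without a factor of degree 1 witnesses compositeness, and
    the degree d of its left factor is the index of the union. *)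
Lemma Comp_bigcup_grades {gT : finGroupType} (n : nat) : (1 < n)%N ->
  Comp gT n =
  \bigcup_(d in [set d : nat | (d %| n)%N /\ (1 < d < n)%N])
    [set u * v | u in grade gT d & v in grade gT (n %/ d)].
Proof.
move=> n_gt1; apply/seteqP; split=> [w [wn [_ _ w_npr]]|w].
  apply: contrapT => w_notin; apply: w_npr; apply/is_prime_gdeg.
    by rewrite wn.
  move=> u v uv_w; have /esym := gdegM u v; rewrite uv_w wn => uv_n.
  apply: contrapT => /not_orP[/eqP u1 /eqP v1]; apply: w_notin.
  have [u_gt0 v_gt0] : (0 < gdeg u)%N /\ (0 < gdeg v)%N.
    by apply/andP; rewrite -muln_gt0 uv_n ltnW.
  have u_gt1 : (1 < gdeg u)%N by rewrite ltn_neqAle eq_sym u1.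
  have v_gt1 : (1 < gdeg v)%N by rewrite ltn_neqAle eq_sym v1.
  exists (gdeg u).
    by split; rewrite -?uv_n ?dvdn_mulr // u_gt1 ltn_Pmulr.
  exists u => //; exists v => //.
  by rewrite /grade /= -uv_n mulKn.
case=> d [dn /andP[d_gt1 d_ltn]] [u ud [v vd uv_w]].
rewrite /grade /= in ud vd.
have wn : gdeg w = n by rewrite -uv_w gdegM ud vd mulnC divnK.
have w_gt1 : (1 < gdeg w)%N by rewrite wn.
have [w0 wU] := gdeg_gt1_nonzero_nonunit w w_gt1.
split=> //; split=> // /(is_prime_gdeg w w_gt1)/(_ u v uv_w).
rewrite ud vd => -[d1|nd1]; first by rewrite d1 in d_gt1.
by move: d_ltn; rewrite -(divnK dn) nd1 mul1n ltnn.
Qed.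

(** No cancellation can occur in N[G], so the support of a product contains
    every product of elements of the two supports. *)
Lemma leq_gmul {gT : finGroupType} (u v : group_semiring gT) (x y : gT) :
  (u x * v y <= (u * v)%R (x * y)%g)%N.
Proof. by rewrite gmulE (bigD1 x) //= mulKg leq_addr. Qed.

Lemma support_other_than {gT : finGroupType} (u : group_semiring gT) (x : gT) :
  (u x < gdeg u)%N -> exists2 y, y != x & (0 < u y)%N.
Proof.
rewrite /gdeg (bigD1 x) //= -{1}[u x]addn0 ltn_add2l lt0n sum_nat_eq0 negb_forall.
by case/existsP=> y; rewrite negb_imply -lt0n => /andP[]; exists y.
Qed.

(** The coefficient 1 at the identity makes the pair (x, x^-1) in
    supp u * supp v unique; any further support elements y of u and z of v are
    then forced to be h x and x^-1 h, and y z = h^2 has nowhere to go. *)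
Lemma is_prime_two_point {gT : finGroupType} (n : nat) (h : gT) :
  (1 < n)%N -> h <> 1%g -> is_prime (gelt 1%g + gelt h *+ (n - 1)).
Proof.
move=> n_gt1 /eqP h1; set w := _ + _.
have wE g : w g = ((g == 1%g) + (g == h) * (n - 1))%N.
  rewrite gaddE ffunE; congr addn; elim: (n - 1)%N => [|m IHm].
    by rewrite mulr0n ffunE muln0.
  by rewrite mulrS gaddE IHm ffunE mulnS.
have wn : gdeg w = n by rewrite gdegD gdegMn !gdeg_gelt mul1n subnKC // ltnW.
apply/is_prime_gdeg; rewrite ?wn // => u v uv_w.
(* Only one term of the convolution sum for the coefficient of the identity is
   nonzero, and it equals 1. *)
have [] : (exists x, [/\ true, u x * v (x^-1 * 1)%g = 1%N &
   forall y, y != x -> true -> u y * v (y^-1 * 1)%g = 0%N])%N.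
  by apply/sum_nat_eq1; rewrite -gmulE uv_w wE eqxx [1%g == h]eq_sym (negPf h1).
move=> x [_ /eqP + uniq]; rewrite mulg1 muln_eq1 => /andP[/eqP ux /eqP vx].
apply: contrapT => /not_orP[u1 v1].
have := gdegM u v; rewrite uv_w wn => uv_n.
have gt1 k : (0 < k -> k <> 1 -> 1 < k)%N by case: k => [|[]].
have [u_gt0 v_gt0] : (0 < gdeg u)%N /\ (0 < gdeg v)%N.
  by apply/andP; rewrite -muln_gt0 -uv_n ltnW.
have [y yx uy] : exists2 y, y != x & (0 < u y)%N.
  by apply: support_other_than; rewrite ux; apply: gt1.
have [z zx vz] : exists2 z, z != x^-1%g & (0 < v z)%N.
  by apply: support_other_than; rewrite vx; apply: gt1.
have supp a b : (0 < u a)%N -> (0 < v b)%N ->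
    (a * b)%g = 1%g \/ (a * b)%g = h.
  move=> ua vb; have := leq_gmul u v a b; rewrite uv_w wE.
  case: eqP => [|_]; first by left.
  by case: eqP => [|_]; [right | rewrite mul0n leqNgt muln_gt0 ua vb].
have yxh : y = (h * x)%g.
  have [||yV|<-] := supp y x^-1%g; rewrite ?vx ?mulgKV //.
  by move/eqP: yV; rewrite -eq_mulgV1 (negPf yx).
have xzh : z = (x^-1 * h)%g.
  have [||xz|<-] := supp x z; rewrite ?ux ?mulKg //.
  by move/eqP: xz; rewrite -eq_invg_mul eq_sym (negPf zx).
(* If y z = e, then y differs from x and also contributes to the identity;
   otherwise h^2 = h. *)
have [yz1|] := supp y z uy vz.
  have := uniq y yx isT; rewrite mulg1 (_ : y^-1%g = z).
    by apply/eqP; rewrite -lt0n muln_gt0 uy.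
  by apply/eqP; rewrite eq_invg_mul yz1.
rewrite yxh xzh -mulgA mulKVg => /eqP.
by rewrite -[X in _ == X]mulg1 (inj_eq (mulgI h)) (negPf h1).
Qed.

(** Listing the coefficients along the enumeration of the group identifies a
    grade with the tuples of length #|gT| and sum n.  Entries of such tuples
    are at most n, so they live in a finite type. *)
Lemma card_grade {gT : finGroupType} (n : nat) :
  grade gT n #= `I_('C(n + #|gT| - 1, #|gT| - 1)).
Proof.
(* The count of tuples below is stated for a length of the form m.+1. *)
set m := (#|gT| - 1)%N.
have cardG : m.+1 = #|gT| by rewrite /m subn1 prednK // -cardsT (cardD1 1%g) inE.
pose X := [set t : m.+1.-tuple 'I_n.+1 | (\sum_(i <- t) i == n)%N]%SET.
pose f (t : m.+1.-tuple 'I_n.+1) : group_semiring gT :=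
  [ffun g => nat_of_ord (nth ord0 t (enum_rank g))].
have f_inj : injective f.
  move=> s t /ffunP st; apply: eq_from_tnth => i; apply: val_inj.
  have := st (enum_val (cast_ord cardG i)).
  by rewrite !ffunE enum_valK /= -!tnth_nth.
have gdeg_f t : gdeg (f t) = (\sum_(i <- t) i)%N.
  rewrite (big_nth ord0) size_tuple big_mkord /gdeg.
  rewrite (reindex (fun g : gT => cast_ord (esym cardG) (enum_rank g))) /=.
    by apply: eq_bigr => g _; rewrite ffunE.
  exists (fun i => enum_val (cast_ord cardG i)) => [g|i] _.
    by rewrite cast_ordKV enum_rankK.
  by rewrite enum_valK cast_ordK.
have <- : f @` [set` X] = grade gT n.
  apply/seteqP; split=> [_ [t /= + <-]|u un].
    by rewrite inE => /eqP tn; rewrite /grade /= gdeg_f.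
  have sz : size [seq (inord (u g) : 'I_n.+1) | g <- enum gT] == m.+1.
    by rewrite size_map -cardE cardG.
  have fu : f (Tuple sz) = u.
    apply/ffunP => g; rewrite ffunE (nth_map 1%g) -?cardE ?ltn_ord //.
    rewrite nth_enum_rank inordK // ltnS -un /gdeg (bigD1 g) //=.
    exact: leq_addr.
  by exists (Tuple sz) => //=; rewrite inE -gdeg_f fu; apply/eqP.
apply: card_eq_trans (inj_card_eq (in2W f_inj)) _.
have -> : [set` X] = enum_val @` [set: 'I_#|X|].
  apply/seteqP; split=> [t /= tX|_ [i _ <-]]; last exact: enum_valP.
  by exists (enum_rank_in tX t); rewrite ?enum_rankK_in.
apply: card_eq_trans (inj_card_eq (in2W enum_val_inj)) _.
have -> : 'C(n + #|gT| - 1, m) = #|X|.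
  by rewrite card_ord_partitions -cardG addnS subn1 addnC.
by rewrite card_eq_sym card_II.
Qed.

Theorem theorem1 (gT : finGroupType) (p : nat) (hp : prime p) :
  (Pr gT p = grade gT p
   /\ Pr gT p #= `I_('C(p + #|gT| - 1, #|gT| - 1)))
  /\ (forall n : nat, (2 <= n)%N ->
        Comp gT n =
        \bigcup_(d in [set d : nat | (d %| n)%N /\ (1 < d < n)%N])
          [set u * v | u in grade gT d & v in grade gT (n %/ d)])
  /\ (forall (n : nat) (h : gT), (2 <= n)%N -> h <> 1%g ->
        is_prime (gelt 1%g + gelt h *+ (n - 1))).
Proof.
split; first by rewrite Pr_prime_grade //; split=> //; exact: card_grade.
by split=> n *; [exact: Comp_bigcup_grades | exact: is_prime_two_point].
Qed.
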